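(* Suppose $1<p<\infty$ and $0<s<1$. Let $f$ be the symbol of a bounded multiplication operator $M_f$ on $\mathcal{Q}_s^p(\mathbb{T})$. Then $\sigma(M_f)=\mathcal{R}(f)$.
   Context: $\mathbb{T}$ is the unit circle, $|d\zeta|$ is arc length, and $|I|$ is the length of an arc $I\subseteq\mathbb{T}$. Functions are complex valued and identified when equal almost everywhere. $\mathcal{Q}_s^p(\mathbb{T})$ is the space of all $f\in L^p(\mathbb{T})$ with $$\|f\|^p_{\mathcal{Q}_s^p(\mathbb{T})}=\sup_{I\subseteq\mathbb{T}}\frac{1}{|I|^s}\int_I\int_I\frac{|f(\zeta)-f(\eta)|^p}{|\zeta-\eta|^{2-s}}\,|d\zeta|\,|d\eta|<\infty,$$ the supremum being over all arcs $I$ of $\mathbb{T}$; it is normed by $\|f\|_{L^p(\mathbb{T})}+\|f\|_{\mathcal{Q}_s^p(\mathbb{T})}$. The multiplication operator with symbol $f$ is $M_f(g)=fg$. For a bounded linear operator $T$ on a Banach space $X$, $\sigma(T)=\{\lambda\in\mathbb{C}: T-\lambda E\text{ is not invertible}\}$, where $E$ is the identity operator on $X$. $\mathcal{R}(f)$ is the essential range of $f$: the set of all $\lambda\in\mathbb{C}$ such that $\{\zeta\in\mathbb{T}:|f(\zeta)-\lambda|<\varepsilon\}$ has positive measure for every $\varepsilon>0$. *)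

(* Defs.v *)
From HB Require Import structures.
From mathcomp Require Import all_boot all_order all_algebra generic_quotient ring_quotient complex.
From mathcomp Require Import all_classical all_reals all_analysis measurable_realfun.
From mathcomp Require Import ring lra.
Set Implicit Arguments.
Unset Strict Implicit.
Unset Printing Implicit Defensive.
Import Order.TTheory GRing.Theory Num.Theory.
Import numFieldNormedType.Exports.
Import ComplexField.Normc.
Local Open Scope complex_scope.
Local Open Scope classical_set_scope.
Local Open Scope ring_scope.

Definition circle (R : realType) := {z : R[i] | `|z| == 1}.

HB.instance Definition _ (R : realType) := Choice.on (circle R).

Section circle.
Context {R : realType}.

Lemma norm_expi (t : R) : `|cos t +i* sin t| == 1 :> R[i].
Proof. by rewrite normc_def /= cos2Dsin2 sqrtr1. Qed.

(* e^{it} *)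
Definition expi (t : R) : circle R := exist _ (cos t +i* sin t) (norm_expi t).

HB.instance Definition _ := isPointed.Build (circle R) (expi 0).

Lemma expi_measurable0 : measurable (expi @^-1` set0).
Proof. by rewrite preimage_set0. Qed.

Lemma expi_measurableC (A : set (circle R)) :
  measurable (expi @^-1` A) -> measurable (expi @^-1` (~` A)).
Proof. by move=> mA; rewrite preimage_setC; exact: measurableC. Qed.

Lemma expi_measurable_bigcup (F : (set (circle R))^nat) :
  (forall i, measurable (expi @^-1` F i)) ->
  measurable (expi @^-1` (\bigcup_i F i)).
Proof. by move=> mF; rewrite preimage_bigcup; exact: bigcupT_measurable. Qed.

(* The Borel sigma-algebra of the circle: as t |-> e^{it} restricts to a Borel
   isomorphism from [0, 2pi[, a set of the circle is Borel iff its preimage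
   is a Borel subset of the line. *)
HB.instance Definition _ := @isMeasurable.Build default_measure_display
  (circle R) [set A | measurable (expi @^-1` A)]
  expi_measurable0 expi_measurableC expi_measurable_bigcup.

Lemma measurable_expi : measurable_fun [set: R] expi.
Proof. by move=> _ A mA; rewrite setTI. Qed.

Definition angle_measure :=
  mrestr (@lebesgue_measure R) (measurable_itv `[0%R, (2 * pi)%R[).

HB.instance Definition _ := Measure.on angle_measure.

Definition arc_length : set (circle R) -> \bar R :=
  pushforward angle_measure expi.

Lemma arc_length0 : arc_length set0 = 0%E.
Proof. by rewrite /arc_length /pushforward preimage_set0 measure0. Qed.

Lemma arc_length_ge0 A : (0 <= arc_length A)%E.
Proof. by rewrite /arc_length /pushforward; exact: measure_ge0. Qed.

Lemma arc_length_sigma_additive : semi_sigma_additive arc_length.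
Proof.
move=> F mF tF mUF; rewrite /arc_length /pushforward preimage_bigcup.
apply: measure_semi_sigma_additive.
- by move=> n; exact: mF.
- apply/trivIsetP => i j _ _ ij; rewrite -preimage_setI.
  by move/trivIsetP : tF => /(_ _ _ _ _ ij) ->//; rewrite preimage_set0.
- by rewrite -preimage_bigcup; exact: mUF.
Qed.

HB.instance Definition _ := isMeasure.Build _ _ _ arc_length
  arc_length0 arc_length_ge0 arc_length_sigma_additive.

Lemma arc_lengthT : arc_length [set: circle R] = (2 * pi)%:E.
Proof.
rewrite /arc_length /pushforward preimage_setT /angle_measure /mrestr setTI.
by rewrite lebesgue_measure_itv /= lte_fin mulr_gt0 ?pi_gt0// oppr0 adde0.
Qed.

Lemma arc_length_finite : fin_num_fun arc_length.
Proof.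
by apply: lty_fin_num_fun; rewrite [ltLHS]arc_lengthT ltry.
Qed.

HB.instance Definition _ := Measure_isFinite.Build _ _ _ arc_length
  arc_length_finite.

End circle.

Section arcs.
Context {R : realType}.

(* The nondegenerate arcs, with or without endpoints; the whole circle is one. *)
Definition is_arc (I : set (circle R)) :=
  (exists J : interval R, I = expi @` [set` J]) /\ (0 < arc_length I)%E.

Lemma cos_eq1 (x : R) : 0 <= x < 2 * pi -> cos x = 1 -> x = 0.
Proof.
move=> /andP[x0 x2pi] cx; have pi0 := @pi_gt0 R.
have [xpi|pix] := leP x pi.
  by apply: cos_inj; rewrite ?cos0// in_itv/=; apply/andP; split; lra.
have : 2 * pi - x = 0; last by lra.
apply: cos_inj; [by rewrite in_itv/=; apply/andP; split; lra..|].
by rewrite cos0 -cosN opprB mulr_natl -cosD2pi subrK.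
Qed.

Lemma cosDint (x : R) (n : nat) : cos (x + 2 * pi * n%:R) = cos x.
Proof. by rewrite mulr_natl mulr_natr; exact/periodicn/cosD2pi. Qed.

Lemma sinDint (x : R) (n : nat) : sin (x + 2 * pi * n%:R) = sin x.
Proof. by rewrite mulr_natl mulr_natr; exact/periodicn/sinD2pi. Qed.

Lemma expiDint (x : R) (n : nat) : expi (x + 2 * pi * n%:R) = expi x.
Proof. by apply: val_inj; rewrite /= cosDint sinDint. Qed.

Lemma cos_eq1_nat (x : R) : 0 <= x -> cos x = 1 -> exists n : nat, x = 2 * pi * n%:R.
Proof.
move=> x0 cx; have pi0 : 0 < 2 * pi :> R by rewrite mulr_gt0 ?pi_gt0.
pose n := Num.truncn (x / (2 * pi)); exists n.
have := truncn_itv (divr_ge0 x0 (ltW pi0)).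
rewrite -/n -natr1 ler_pdivlMr// ltr_pdivrMr// => /andP[n1 n2].
apply/eqP; rewrite -subr_eq0; apply/eqP; apply: cos_eq1.
  by apply/andP; split; lra.
by rewrite -(cosDint _ n) subrK.
Qed.

Lemma expi_eq (t u : R) : expi t = expi u -> t <= u ->
  exists n : nat, u = t + 2 * pi * n%:R.
Proof.
move=> /(congr1 val)[ctu stu] tu.
have [||n ntu] := @cos_eq1_nat (u - t); first by rewrite subr_ge0.
  by rewrite cosB ctu stu -!expr2 cos2Dsin2.
by exists n; rewrite -ntu addrC subrK.
Qed.

Lemma measurable_arc I : is_arc I -> measurable I.
Proof.
move=> [[J ->] _]; rewrite /measurable/=.
rewrite (_ : _ @^-1` _ =
  (\bigcup_(n : nat) ((fun t => t + 2 * pi * n%:R) @^-1` [set` J])) `|`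
  (\bigcup_(n : nat) ((fun t => t - 2 * pi * n%:R) @^-1` [set` J]))).
  apply: measurableU; apply: bigcupT_measurable => n;
    rewrite -[X in measurable X]setTI;
    by apply: measurable_funD => //; exact: measurable_itv.
apply/seteqP; split => [t /= [u Ju]|t].
  move=> eut; have [ut|/ltW tu] := leP u t.
    have [n ->] := expi_eq eut ut.
    by right; exists n => //=; rewrite addrK.
  have [n nE] := expi_eq (esym eut) tu.
  by left; exists n => //=; rewrite -nE.
case=> -[n _ /= Jt].
  by exists (t + 2 * pi * n%:R) => //; rewrite expiDint.
by exists (t - 2 * pi * n%:R) => //; rewrite -[in RHS](subrK (2 * pi * n%:R) t) expiDint.
Qed.

End arcs.

Section complex_measurability.
Context {R : realType} {d} {T : measurableType d}.
Implicit Types (f g : T -> R[i]).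

Definition cmeasurable f :=
  measurable_fun [set: T] (fun x => complex.Re (f x)) /\
  measurable_fun [set: T] (fun x => complex.Im (f x)).

Lemma cmeasurable_cst c : cmeasurable (fun=> c).
Proof. by split; exact: measurable_cst. Qed.

Lemma cmeasurableD f g : cmeasurable f -> cmeasurable g -> cmeasurable (f \+ g).
Proof.
move=> [rf mf] [rg mg]; split; [rewrite [X in measurable_fun _ X](_ : _ =
  (fun x => complex.Re (f x)) \+ (fun x => complex.Re (g x)))
  | rewrite [X in measurable_fun _ X](_ : _ =
  (fun x => complex.Im (f x)) \+ (fun x => complex.Im (g x)))].
- exact: measurable_funD.
- by apply/funext => x /=; case: (f x) (g x) => a b [].
- exact: measurable_funD.
- by apply/funext => x /=; case: (f x) (g x) => a b [].
Qed.

Lemma cmeasurableM f g : cmeasurable f -> cmeasurable g -> cmeasurable (f \* g).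
Proof.
move=> [rf mf] [rg mg]; split; [rewrite [X in measurable_fun _ X](_ : _ =
  ((fun x => complex.Re (f x)) \* (fun x => complex.Re (g x))) \-
  ((fun x => complex.Im (f x)) \* (fun x => complex.Im (g x))))
  | rewrite [X in measurable_fun _ X](_ : _ =
  ((fun x => complex.Re (f x)) \* (fun x => complex.Im (g x))) \+
  ((fun x => complex.Im (f x)) \* (fun x => complex.Re (g x))))].
- by apply: measurable_funB; exact: measurable_funM.
- by apply/funext => x /=; case: (f x) (g x) => a b [].
- by apply: measurable_funD; exact: measurable_funM.
- by apply/funext => x /=; case: (f x) (g x) => a b [].
Qed.

Lemma cmeasurableN f : cmeasurable f -> cmeasurable (\- f).
Proof.
move=> mf; have := cmeasurableM (cmeasurable_cst (-1)) mf.
by congr cmeasurable; apply/funext => x /=; rewrite mulN1r.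
Qed.

Lemma cmeasurable_real (f : T -> R) : measurable_fun [set: T] f ->
  cmeasurable (fun x => (f x)%:C).
Proof. by move=> mf; split=> //=; exact: measurable_cst. Qed.

Lemma measurable_normc f : cmeasurable f ->
  measurable_fun [set: T] (fun x => normc (f x)).
Proof.
move=> [rf mf]; rewrite [X in measurable_fun _ X](_ : _ = (@Num.sqrt R) \o
  (fun x => complex.Re (f x) ^+ 2 + complex.Im (f x) ^+ 2)).
  have msqrt : measurable_fun [set: R] (@Num.sqrt R).
    by apply: continuous_measurable_fun; exact: sqrt_continuous.
  apply: (measurableT_comp msqrt).
  by apply: measurable_funD; exact: measurable_funX.
by apply/funext => x /=; case: (f x).
Qed.

End complex_measurability.

Section complex_Lnorm.
Context {R : realType} {d} {T : measurableType d}.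
Variables (mu : {measure set T -> \bar R}) (p : R).
Implicit Types (f g : T -> R[i]).

Definition cLnorm f : \bar R := 'N[mu]_p%:E[(fun x => (normc (f x))%:E)]%E.

Lemma normc_ge0 (z : R[i]) : 0 <= normc z.
Proof. by case: z => a b; exact: sqrtr_ge0. Qed.

Lemma cLnorm_ge0 f : (0 <= cLnorm f)%E.
Proof. exact: Lnorm_ge0. Qed.

Hypothesis p1 : 1 <= p.

Lemma p_gt0 : 0 < p. Proof. exact: lt_le_trans p1. Qed.

Lemma ge0_LnormE (h : T -> R) : (forall x, 0 <= h x) ->
  'N[mu]_p%:E[EFin \o h]%E = ((\int[mu]_x (h x `^ p)%:E) `^ p^-1)%E.
Proof.
move=> h0; rewrite unlock.
by under eq_integral => x _ do rewrite /= ger0_norm//.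
Qed.

Lemma cLnormE f : cLnorm f = ((\int[mu]_x (normc (f x) `^ p)%:E) `^ p^-1)%E.
Proof. by rewrite -ge0_LnormE// => x; exact: normc_ge0. Qed.

Lemma measurable_normc_powR f : cmeasurable f ->
  measurable_fun [set: T] (fun x => (normc (f x) `^ p)%:E).
Proof.
move=> mf; apply/measurable_EFinP.
exact: (measurableT_comp (measurable_powR p) (measurable_normc mf)).
Qed.

Lemma cLnormD f g : cmeasurable f -> cmeasurable g ->
  (cLnorm (f \+ g)%R <= cLnorm f + cLnorm g)%E.
Proof.
move=> mf mg; have nf := measurable_normc mf; have ng := measurable_normc mg.
apply: le_trans (minkowski_EFin mu nf ng p1).
rewrite cLnormE ge0_LnormE; last by move=> x; rewrite addr_ge0 ?normc_ge0.
apply: gt0_ler_poweR.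
- by rewrite invr_ge0 ltW// p_gt0.
- rewrite in_itv/= leey andbT; apply: integral_ge0 => x _.
  by rewrite lee_fin powR_ge0.
- rewrite in_itv/= leey andbT; apply: integral_ge0 => x _.
  by rewrite lee_fin powR_ge0.
apply: ge0_le_integral => //.
- by move=> x _; rewrite lee_fin powR_ge0.
- exact/measurable_normc_powR/cmeasurableD.
- apply/measurable_EFinP.
  exact: (measurableT_comp (measurable_powR p) (measurable_funD nf ng)).
move=> x _ /=; rewrite lee_fin ge0_ler_powR ?nnegrE ?addr_ge0 ?normc_ge0//.
- by rewrite ltW// p_gt0.
by rewrite le_normcD.
Qed.

Lemma cLnormZ (c : R[i]) f : cmeasurable f ->
  cLnorm (fun x => c * f x) = ((normc c)%:E * cLnorm f)%E.
Proof.
move=> mf; rewrite !cLnormE.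
under eq_integral do rewrite normcM powRM ?normc_ge0// EFinM.
rewrite ge0_integralZl ?lee_fin ?powR_ge0//; last 2 first.
- exact: measurable_normc_powR.
- by move=> x _; rewrite lee_fin powR_ge0.
rewrite poweRM ?integral_ge0 ?lee_fin ?powR_ge0//; last first.
  by move=> x _; rewrite lee_fin powR_ge0.
by rewrite poweR_EFin -powRrM mulfV ?gt_eqF ?p_gt0// powRr1 ?normc_ge0.
Qed.

Lemma cLnorm_eq0 f : cmeasurable f -> cLnorm f = 0%E -> f = cst 0 %[ae mu].
Proof.
move=> mf N0; have mnf : measurable_fun [set: T] (fun x => (normc (f x))%:E).
  exact/measurable_EFinP/measurable_normc.
have p0 : (0 < p%:E)%E by rewrite lte_fin p_gt0.
by apply: filterS (Lnorm_eq0_eq0 mnf p0 N0) => x /(_ I)/= [] /eq0_normc.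
Qed.

Lemma cLnorm_ae0 f : cmeasurable f -> f = cst 0 %[ae mu] -> cLnorm f = 0%E.
Proof.
move=> mf f0; rewrite cLnormE (_ : integral _ _ _ = 0%E); last first.
  rewrite (ge0_ae_eq_integral measurableT _ (measurable_cst 0%E)).
  - by rewrite integral0.
  - exact: measurable_normc_powR.
  - by move=> x _; rewrite lee_fin powR_ge0.
  - by [].
  by apply: filterS f0 => x /(_ I)/= -> _; rewrite normc0 powR0// gt_eqF ?p_gt0.
by rewrite poweR0r// invr_eq0 gt_eqF// p_gt0.
Qed.

End complex_Lnorm.

Definition circle_val (R : realType) (z : circle R) : R[i] := sval z.

Definition Lp_norm {R : realType} (p : R) (f : circle R -> R[i]) : \bar R :=
  cLnorm arc_length p f.

(* At zeta = eta the integrand is 0 / 0 = 0. *)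
Definition Q_energy {R : realType} (p s : R) (f : circle R -> R[i])
    (I : set (circle R)) : \bar R :=
  (\int[arc_length]_(z in I) \int[arc_length]_(w in I)
    (normc (f z - f w) `^ p /
     normc (circle_val z - circle_val w) `^ (2 - s))%:E)%E.

Definition Q_mean {R : realType} (p s : R) (f : circle R -> R[i])
    (I : set (circle R)) : \bar R :=
  (((fine (arc_length I) `^ s)^-1)%:E * Q_energy p s f I)%E.

HB.lock Definition Q_seminorm {R : realType} (p s : R)
    (f : circle R -> R[i]) : \bar R :=
  (ereal_sup [set Q_mean p s f I | I in is_arc] `^ p^-1)%E.
Canonical locked_Q_seminorm := Unlockable Q_seminorm.unlock.

Definition Q_space {R : realType} (p s : R) : set (circle R -> R[i]) :=
  [set f | [/\ cmeasurable f, (Lp_norm p f < +oo)%E &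
               (Q_seminorm p s f < +oo)%E]].

Section Q_norm.
Context {R : realType}.
Variables p s : R.
Implicit Types (f g : circle R -> R[i]) (I : set (circle R)).
Local Notation mu := (@arc_length R).
Local Notation Lp_norm := (Lp_norm p).
Local Notation Q_energy := (Q_energy p s).
Local Notation Q_mean := (Q_mean p s).
Local Notation Q_seminorm := (Q_seminorm p s).
Local Notation Q_space := (Q_space p s).

Lemma cmeasurable_circle_val : cmeasurable (@circle_val R).
Proof.
have E (h : circle R -> R) : continuous (h \o expi) -> measurable_fun setT h.
  move=> ch _ A mA; rewrite setTI /measurable/= -comp_preimage.
  rewrite -[X in measurable X]setTI.
  by apply: continuous_measurable_fun.
by split; apply: E; [exact: continuous_cos|exact: continuous_sin].
Qed.

Lemma cmeasurable_diff f : cmeasurable f ->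
  cmeasurable (fun z : circle R * circle R => f z.1 - f z.2).
Proof.
move=> [rf mf]; apply: cmeasurableD; last apply: cmeasurableN; split.
- exact: (measurableT_comp rf measurable_fst).
- exact: (measurableT_comp mf measurable_fst).
- exact: (measurableT_comp rf measurable_snd).
- exact: (measurableT_comp mf measurable_snd).
Qed.

Definition Q_kernel I (z : circle R * circle R) : R :=
  \1_I z.1 * \1_I z.2 / normc (circle_val z.1 - circle_val z.2) `^ (2 - s).

Definition Q_diff f I (z : circle R * circle R) : R[i] :=
  (((fine (mu I) `^ s)^-1 * Q_kernel I z) `^ p^-1)%:C * (f z.1 - f z.2).

Lemma Q_kernel_ge0 I z : 0 <= Q_kernel I z.
Proof. by rewrite /Q_kernel divr_ge0 ?powR_ge0// mulr_ge0. Qed.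

Lemma measurable_Q_kernel I : measurable I ->
  measurable_fun [set: circle R * circle R] (Q_kernel I).
Proof.
move=> mI; apply: measurable_funM.
  apply: measurable_funM.
    exact: (measurableT_comp (measurable_indic mI) measurable_fst).
  exact: (measurableT_comp (measurable_indic mI) measurable_snd).
have mn := measurable_normc (cmeasurable_diff cmeasurable_circle_val).
have -> : (fun x : circle R * circle R =>
    (normc (circle_val x.1 - circle_val x.2) `^ (2 - s))^-1) =
    (fun x => normc (circle_val x.1 - circle_val x.2) `^ (- (2 - s))).
  by apply/funext => x; rewrite powRN.
exact: (measurableT_comp (measurable_powR (- (2 - s))) mn).
Qed.

Lemma cmeasurable_Q_diff f I : cmeasurable f -> measurable I ->
  cmeasurable (Q_diff f I).
Proof.
move=> mf mI; apply: cmeasurableM (cmeasurable_diff mf).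
apply: cmeasurable_real; apply: (measurableT_comp (measurable_powR p^-1)).
by apply: measurable_funM => //; exact: measurable_Q_kernel.
Qed.

Lemma Q_energyE f I : cmeasurable f -> measurable I ->
  Q_energy f I = (\int[mu \x mu]_z
    (Q_kernel I z * normc (f z.1 - f z.2) `^ p)%:E)%E.
Proof.
move=> mf mI; rewrite fubini_tonelli1.
- rewrite /Q_energy integral_mkcond; apply: eq_integral => z _.
  rewrite patchE /fubini_F/=; case: ifPn => zI.
    rewrite integral_mkcond; apply: eq_integral => w _.
    rewrite patchE /Q_kernel/= !indicE zI; case: ifPn => wI.
      by rewrite !mul1r mulrC.
    by rewrite mulr0 !mul0r.
  rewrite integral0_eq// => w _.
  by rewrite /Q_kernel/= indicE (negbTE zI) !mul0r.
- apply/measurable_EFinP/measurable_funM; first exact: measurable_Q_kernel.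
  exact: (measurableT_comp (measurable_powR p)
    (measurable_normc (cmeasurable_diff mf))).
- by move=> z; rewrite lee_fin mulr_ge0 ?Q_kernel_ge0 ?powR_ge0.
Qed.

Hypothesis p1 : 1 <= p.
Let p0 : 0 < p. Proof. exact: p_gt0 p1. Qed.

Lemma Q_meanE f I : cmeasurable f -> measurable I ->
  (Q_mean f I `^ p^-1)%E = cLnorm (mu \x mu)%E p (Q_diff f I).
Proof.
move=> mf mI; rewrite cLnormE /Q_mean Q_energyE//; congr (_ `^ _)%E.
have c0 : 0 <= (fine (mu I) `^ s)^-1 by rewrite invr_ge0 powR_ge0.
rewrite -ge0_integralZl ?lee_fin//.
- apply: eq_integral => z _; rewrite -EFinM /Q_diff normcM powRM ?normc_ge0//.
  rewrite mulrA; congr (_ * _)%:E; rewrite /= expr0n/= addr0 sqrtr_sqr.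
  rewrite ger0_norm ?powR_ge0// -powRrM mulVf ?gt_eqF// powRr1//.
  by rewrite mulr_ge0 ?Q_kernel_ge0.
- apply/measurable_EFinP/measurable_funM; first exact: measurable_Q_kernel.
  exact: (measurableT_comp (measurable_powR p)
    (measurable_normc (cmeasurable_diff mf))).
- by move=> z _; rewrite lee_fin mulr_ge0 ?Q_kernel_ge0 ?powR_ge0.
Qed.

Lemma Q_mean_ge0 f I : (0 <= Q_mean f I)%E.
Proof.
rewrite mule_ge0 ?lee_fin ?invr_ge0 ?powR_ge0//.
apply: integral_ge0 => z _; apply: integral_ge0 => w _.
by rewrite lee_fin divr_ge0 ?powR_ge0.
Qed.

Lemma Q_seminorm_ge0 f : (0 <= Q_seminorm f)%E.
Proof. by rewrite unlock; exact: poweR_ge0. Qed.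

Lemma poweRpVK (x : \bar R) : (0 <= x)%E -> ((x `^ p^-1) `^ p = x)%E.
Proof. by move=> x0; rewrite -poweRrM mulVf ?gt_eqF// poweRe1. Qed.

Lemma poweRpK (x : \bar R) : (0 <= x)%E -> ((x `^ p) `^ p^-1 = x)%E.
Proof. by move=> x0; rewrite -poweRrM mulfV ?gt_eqF// poweRe1. Qed.

Lemma ge0_lee_poweR (r : R) (x y : \bar R) : 0 <= r ->
  (0 <= x)%E -> (x <= y)%E -> (x `^ r <= y `^ r)%E.
Proof.
move=> r0 x0 xy; apply: gt0_ler_poweR => //; rewrite in_itv/= leey andbT//.
exact: le_trans xy.
Qed.

Lemma is_arcT : is_arc [set: circle R].
Proof.
split; last by rewrite arc_lengthT lte_fin mulr_gt0 ?pi_gt0.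
exists `]-oo, +oo[; apply/seteqP; split => // -[[a b] ab] _ /=.
have nab : `|a +i* b| == 1 := ab.
move: nab; rewrite normc_def/= => /eqP[]/(congr1 (fun x => x ^+ 2)).
rewrite sqr_sqrtr ?addr_ge0 ?sqr_ge0// expr1n => ab1.
have a1 : -1 <= a <= 1.
  rewrite -ler_norml -sqrtr_sqr -sqrtr1 ler_wsqrtr// -ab1 lerDl sqr_ge0//.
have acosa := acosK a1.
have sacos : sin (acos a) ^+ 2 = b ^+ 2.
  by rewrite sin2cos2 acosa -ab1 addrAC subrr add0r.
move/eqP : sacos; rewrite eqf_sqr => /orP[]/eqP sb.
  by exists (acos a) => //; apply: val_inj; rewrite /= acosa sb.
by exists (- acos a) => //; apply: val_inj; rewrite /= cosN sinN acosa sb opprK.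
Qed.

Lemma Q_sup_ge0 f : (0 <= ereal_sup [set Q_mean f I | I in is_arc])%E.
Proof.
apply: le_trans (Q_mean_ge0 f [set: circle R]) _; apply: ereal_sup_ubound.
by exists [set: circle R] => //; exact: is_arcT.
Qed.

Lemma Q_seminorm_lub f (M : \bar R) : (0 <= M)%E ->
  (forall I, is_arc I -> (Q_mean f I `^ p^-1 <= M)%E) ->
  (Q_seminorm f <= M)%E.
Proof.
move=> M0 H; rewrite unlock -[leRHS]poweRpK//; apply: ge0_lee_poweR.
- by rewrite invr_ge0 ltW.
- exact: Q_sup_ge0.
apply: ge_ereal_sup => _ [I aI <-]; rewrite -[leLHS]poweRpVK ?Q_mean_ge0//.
by apply: ge0_lee_poweR; [exact: ltW|exact: poweR_ge0|exact: H].
Qed.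

Lemma Q_seminorm_ub f I : is_arc I -> (Q_mean f I `^ p^-1 <= Q_seminorm f)%E.
Proof.
move=> aI; rewrite unlock; apply: ge0_lee_poweR; rewrite ?invr_ge0 ?(ltW p0) ?Q_mean_ge0//.
by apply: ereal_sup_ubound; exists I.
Qed.

Lemma Q_diff_ub f I : cmeasurable f -> is_arc I ->
  (cLnorm (mu \x mu)%E p (Q_diff f I) <= Q_seminorm f)%E.
Proof.
move=> mf aI; rewrite -(Q_meanE mf (measurable_arc aI)).
exact: Q_seminorm_ub.
Qed.

Lemma Q_diff_lub f (M : \bar R) : cmeasurable f -> (0 <= M)%E ->
  (forall I, is_arc I -> (cLnorm (mu \x mu)%E p (Q_diff f I) <= M)%E) ->
  (Q_seminorm f <= M)%E.
Proof.
move=> mf M0 H; apply: Q_seminorm_lub => // I aI.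
by rewrite (Q_meanE mf (measurable_arc aI)); exact: H.
Qed.

Lemma Q_diffD f g I : Q_diff (f \+ g) I = Q_diff f I \+ Q_diff g I.
Proof. apply/funext => z; rewrite /Q_diff -[RHS]mulrDr; congr (_ * _).
by rewrite addrACA -opprD. Qed.

Lemma Q_diffZ (c : R[i]) f I :
  Q_diff (fun x => c * f x) I = (fun z => c * Q_diff f I z).
Proof. by apply/funext => z; rewrite /Q_diff -mulrBr mulrCA. Qed.

Lemma Q_seminormD f g : cmeasurable f -> cmeasurable g ->
  (Q_seminorm (f \+ g)%R <= Q_seminorm f + Q_seminorm g)%E.
Proof.
move=> mf mg; apply: Q_diff_lub (cmeasurableD mf mg) _ _ => [|I aI].
  by rewrite adde_ge0 ?Q_seminorm_ge0.
have mI := measurable_arc aI; rewrite Q_diffD.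
apply: le_trans (leeD (Q_diff_ub mf aI) (Q_diff_ub mg aI)).
exact: (cLnormD _ p1 (cmeasurable_Q_diff mf mI) (cmeasurable_Q_diff mg mI)).
Qed.

Lemma Q_seminormZ_le (c : R[i]) f : cmeasurable f ->
  (Q_seminorm (fun x => c * f x)%R <= (normc c)%:E * Q_seminorm f)%E.
Proof.
move=> mf; have mcf := cmeasurableM (cmeasurable_cst c) mf.
apply: Q_diff_lub mcf _ _ => [|I aI].
  by rewrite mule_ge0 ?lee_fin ?normc_ge0 ?Q_seminorm_ge0.
have mI := measurable_arc aI; rewrite Q_diffZ.
rewrite (cLnormZ _ p1 c (cmeasurable_Q_diff mf mI)).
by apply: lee_wpmul2l; [rewrite lee_fin normc_ge0|exact: Q_diff_ub].
Qed.

Lemma Q_seminormZ (c : R[i]) f : cmeasurable f ->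
  Q_seminorm (fun x => c * f x) = ((normc c)%:E * Q_seminorm f)%E.
Proof.
move=> mf; apply/eqP; rewrite eq_le Q_seminormZ_le//=.
have [->|c0] := eqVneq c 0.
  by rewrite normc0 mul0e Q_seminorm_ge0.
have nc0 : normc c != 0 by apply: contra_neq c0; exact: eq0_normc.
have mcf : cmeasurable (fun x => c * f x).
  exact: cmeasurableM (cmeasurable_cst _) mf.
have := @Q_seminormZ_le c^-1 _ mcf.
rewrite (_ : (fun x => _) = f); last by apply/funext => x; rewrite mulKf.
rewrite normcV => le1.
apply: le_trans (lee_wpmul2l _ le1) _; first by rewrite lee_fin normc_ge0.
by rewrite muleA -EFinM divff// mul1e.
Qed.

Lemma Q_seminorm_ae0 f : cmeasurable f -> f = cst 0 %[ae mu] ->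
  Q_seminorm f = 0%E.
Proof.
move=> mf f0; apply/eqP; rewrite eq_le Q_seminorm_ge0 andbT.
apply: Q_seminorm_lub => // I aI; have mI := measurable_arc aI.
have mh : measurable_fun [set: circle R * circle R]
    (fun z => (Q_kernel I z * normc (f z.1 - f z.2) `^ p)%:E).
  apply/measurable_EFinP/measurable_funM; first exact: measurable_Q_kernel.
  exact: (measurableT_comp (measurable_powR p)
    (measurable_normc (cmeasurable_diff mf))).
have h0 z : (0 <= (Q_kernel I z * normc (f z.1 - f z.2) `^ p)%:E)%E.
  by rewrite lee_fin mulr_ge0 ?Q_kernel_ge0 ?powR_ge0.
rewrite /Q_mean Q_energyE// fubini_tonelli1//.
rewrite (ge0_ae_eq_integral measurableT _ (measurable_cst 0%E)).
- by rewrite integral0 mule0 poweR0r// invr_eq0 gt_eqF.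
- exact: measurable_fun_fubini_tonelli_F.
- by move=> z _; apply: integral_ge0 => w _; exact: h0.
- by [].
apply: (filterS _ (f0)) => z /(_ Logic.I)/= fz0 _.
rewrite /fubini_F (ge0_ae_eq_integral measurableT _ (measurable_cst 0%E)).
- by rewrite integral0.
- exact: (measurableT_comp mh (measurable_pair1 z)).
- by move=> w _; exact: h0.
- by [].
apply: (filterS _ (f0)) => w /(_ Logic.I)/= fw0 _.
by rewrite fz0 fw0 subrr normc0 powR0 ?mulr0// gt_eqF.
Qed.

Lemma Lp_norm_ae0 f : cmeasurable f -> f = cst 0 %[ae mu] -> Lp_norm f = 0%E.
Proof. exact: cLnorm_ae0. Qed.

Definition Q_norm f : R := fine (Lp_norm f) + fine (Q_seminorm f).

Lemma Q_norm_fin f : Q_space f ->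
  ((Lp_norm f \is a fin_num) * (Q_seminorm f \is a fin_num))%type.
Proof.
move=> [_ fp fs]; split; first by rewrite ge0_fin_numE// cLnorm_ge0.
by rewrite ge0_fin_numE// Q_seminorm_ge0.
Qed.

Lemma Q_space_ae0 f : cmeasurable f -> f = cst 0 %[ae mu] -> Q_space f.
Proof. by move=> mf f0; split; rewrite // ?Lp_norm_ae0 ?Q_seminorm_ae0. Qed.

Lemma Q_spaceD f g : Q_space f -> Q_space g -> Q_space (f \+ g).
Proof.
move=> [mf fp fs] [mg gp gs]; split; first exact: cmeasurableD.
  exact: le_lt_trans (cLnormD _ p1 mf mg) (lte_add_pinfty fp gp).
exact: le_lt_trans (Q_seminormD mf mg) (lte_add_pinfty fs gs).
Qed.

Lemma Q_spaceZ (c : R[i]) f : Q_space f -> Q_space (fun x => c * f x).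
Proof.
move=> [mf fp fs]; split; first exact: cmeasurableM (cmeasurable_cst c) mf.
  rewrite /Lp_norm cLnormZ//.
  by apply: lte_mul_pinfty fp => //; rewrite lee_fin normc_ge0.
rewrite Q_seminormZ//.
by apply: lte_mul_pinfty fs => //; rewrite lee_fin normc_ge0.
Qed.

Lemma Q_norm_ge0 f : 0 <= Q_norm f.
Proof. by rewrite addr_ge0 ?fine_ge0 ?cLnorm_ge0 ?Q_seminorm_ge0. Qed.

Lemma Q_normD f g : Q_space f -> Q_space g ->
  Q_norm (f \+ g) <= Q_norm f + Q_norm g.
Proof.
move=> Qf Qg; have [fp fs] := Q_norm_fin Qf; have [gp gs] := Q_norm_fin Qg.
have [fgp fgs] := Q_norm_fin (Q_spaceD Qf Qg).
have [mf _ _] := Qf; have [mg _ _] := Qg.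
rewrite /Q_norm [leRHS]addrACA; apply: lerD.
  rewrite -lee_fin EFinD (fineK fp) (fineK gp) (fineK fgp).
  exact: (cLnormD _ p1 mf mg).
rewrite -lee_fin EFinD (fineK fs) (fineK gs) (fineK fgs).
exact: (Q_seminormD mf mg).
Qed.

Lemma Q_normZ (c : R[i]) f : Q_space f ->
  Q_norm (fun x => c * f x) = normc c * Q_norm f.
Proof.
move=> Qf; have [fp fs] := Q_norm_fin Qf; have [mf _ _] := Qf.
rewrite /Q_norm {1}/Lp_norm (cLnormZ _ p1 c mf) Q_seminormZ//.
by rewrite (fineM _ fs)// (fineM _ fp)// -mulrDr.
Qed.

Lemma Q_norm_ae0 f : cmeasurable f -> f = cst 0 %[ae mu] -> Q_norm f = 0.
Proof. by move=> mf f0; rewrite /Q_norm Lp_norm_ae0// Q_seminorm_ae0// addr0. Qed.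

Lemma Q_norm0_ae f : Q_space f -> Q_norm f = 0 -> f = cst 0 %[ae mu].
Proof.
move=> Qf /eqP; have [fp _] := Q_norm_fin Qf; have [mf _ _] := Qf.
rewrite paddr_eq0 ?fine_ge0 ?cLnorm_ge0 ?Q_seminorm_ge0// => /andP[/eqP f0 _].
by apply: (cLnorm_eq0 p1 mf); rewrite -/(Lp_norm f) -(fineK fp) f0.
Qed.

End Q_norm.

Section Q_functions.
Context {R : realType} (p s : R) (p1 : 1 < p).
Local Notation mu := (@arc_length R).

Definition Q_pred : {pred circle R -> R[i]} :=
  [pred f | `[< Q_space p s f >]].

Lemma Q_pred_submod_closed : submod_closed Q_pred.
Proof.
split=> [|c f g /asboolP Qf /asboolP Qg]; apply/asboolP.
  apply: Q_space_ae0; first exact: ltW.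
    exact: cmeasurable_cst.
  exact: aeW.
by apply: Q_spaceD Qg; [exact: ltW|apply: Q_spaceZ => //; exact: ltW].
Qed.

HB.instance Definition _ :=
  GRing.isSubmodClosed.Build _ _ Q_pred Q_pred_submod_closed.

Record Q_fun := MkQ_fun {
  Q_fun_val :> circle R -> R[i] ;
  Q_funP : Q_fun_val \in Q_pred }.

HB.instance Definition _ := [isSub for Q_fun_val].
HB.instance Definition _ := [Choice of Q_fun by <:].
HB.instance Definition _ := [SubChoice_isSubLmodule of Q_fun by <:].

Lemma Q_fun_space (f : Q_fun) : Q_space p s f.
Proof. exact/asboolP/Q_funP. Qed.

Definition Q_ae0 : {pred Q_fun} :=
  [pred f : Q_fun | `[< Q_fun_val f = cst 0 %[ae mu] >]].

Lemma Q_ae0_zmod_closed : zmod_closed Q_ae0.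
Proof.
split=> [|f g /asboolP f0 /asboolP g0]; apply/asboolP; first exact: aeW.
apply: filterS2 f0 g0 => x /(_ I) fx /(_ I) gx _.
by rewrite [LHS](_ : _ = Q_fun_val f x - Q_fun_val g x)// fx gx subrr.
Qed.

HB.instance Definition _ :=
  GRing.isZmodClosed.Build _ Q_ae0 Q_ae0_zmod_closed.

(* The functions of the space modulo equality almost everywhere. *)
Definition Qps := Quotient.quot Q_ae0.
HB.instance Definition _ := GRing.Zmodule.on Qps.
HB.instance Definition _ := Quotient.on Qps.

Local Open Scope quotient_scope.

Definition Qps_fun (x : Qps) : circle R -> R[i] := Q_fun_val (repr x).

Lemma Qps_eqP (f g : Q_fun) :
  reflect (Q_fun_val f = Q_fun_val g %[ae mu]) (\pi_Qps f == \pi_Qps g).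
Proof.
rewrite -[_ == _](Quotient.idealrBE Q_ae0 f g).
apply: (iffP (asboolP _)); apply: filterS => x /(_ I) fg _.
  by apply/eqP; rewrite -subr_eq0; exact/eqP.
by rewrite [LHS](_ : _ = f x - g x)// fg subrr.
Qed.

Lemma Qps_pi_repr (f : Q_fun) :
  Q_fun_val (repr (\pi_Qps f)) = Q_fun_val f %[ae mu].
Proof. by apply/Qps_eqP; rewrite reprK. Qed.

Definition Qps_scale (c : R[i]) (x : Qps) : Qps := \pi_Qps (c *: repr x).

Lemma Qps_pi_scale c (f : Q_fun) : Qps_scale c (\pi_Qps f) = \pi_Qps (c *: f).
Proof.
apply/eqP/Qps_eqP; apply: filterS (Qps_pi_repr f) => x /(_ I) fx _.
by rewrite [LHS](_ : _ = c * repr (\pi_Qps f) x)// fx.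
Qed.

Lemma Qps_scaleA a b x : Qps_scale a (Qps_scale b x) = Qps_scale (a * b) x.
Proof. by rewrite {2}/Qps_scale Qps_pi_scale scalerA. Qed.

Lemma Qps_scale1 : left_id 1 Qps_scale.
Proof. by move=> x; rewrite /Qps_scale scale1r reprK. Qed.

Lemma Qps_scaleDr : right_distributive Qps_scale +%R.
Proof.
move=> c x y; rewrite -[x]reprK -[y]reprK -raddfD /= !Qps_pi_scale.
by rewrite scalerDr raddfD.
Qed.

Lemma Qps_scaleDl x : {morph Qps_scale^~ x : a b / a + b}.
Proof.
by move=> a b; rewrite -[x]reprK !Qps_pi_scale scalerDl raddfD.
Qed.

HB.instance Definition _ := GRing.Zmodule_isLmodule.Build R[i] Qps
  Qps_scaleA Qps_scale1 Qps_scaleDr Qps_scaleDl.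

Definition Qps_norm (x : Qps) : R[i] := (Q_norm p s (repr x))%:C.

Lemma Qps_norm_pi (f : Q_fun) : Qps_norm (\pi_Qps f) = (Q_norm p s f)%:C.
Proof.
have p1' := ltW p1.
have le (g h : Q_fun) : Q_fun_val g = Q_fun_val h %[ae mu] ->
    Q_norm p s g <= Q_norm p s h.
  move=> gh; have gh0 : Q_norm p s (g - h : Q_fun) = 0.
    apply: Q_norm_ae0 => //; first by have [] := Q_fun_space (g - h).
    apply: filterS gh => x /(_ I) ghx _.
    by rewrite [LHS](_ : _ = g x - h x)// ghx subrr.
  have {1}-> : Q_fun_val g = (g - h : Q_fun) \+ h.
    by apply/funext => x; rewrite [RHS](_ : _ = g x - h x + h x)// subrK.
  by rewrite -[leRHS]add0r -gh0; apply: Q_normD => //; exact: Q_fun_space.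
congr _%:C; apply/le_anti/andP; split; apply: le; first exact: Qps_pi_repr.
by apply: filterS (Qps_pi_repr f) => x /(_ I) -> _.
Qed.

Lemma Qps_normD x y : Qps_norm (x + y) <= Qps_norm x + Qps_norm y.
Proof.
rewrite -[x]reprK -[y]reprK -raddfD !Qps_norm_pi -rmorphD/= lecR.
by apply: Q_normD; [exact: ltW|exact: Q_fun_space..].
Qed.

Lemma Qps_normZ (c : R[i]) (x : Qps) : Qps_norm (c *: x) = `|c| * Qps_norm x.
Proof.
rewrite [LHS]Qps_norm_pi /Qps_norm -[`|c|]/((normc c)%:C) -rmorphM/=.
congr _%:C; apply: Q_normZ; [exact: ltW|exact: Q_fun_space].
Qed.

Lemma Qps_norm0_eq0 x : Qps_norm x = 0 -> x = 0.
Proof.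
move=> [x0]; rewrite -[x]reprK -[0](raddf0 \pi_Qps).
by apply/eqP/Qps_eqP; apply: Q_norm0_ae x0; [exact: ltW|exact: Q_fun_space].
Qed.

HB.instance Definition _ :=
  Lmodule_isNormed.Build R[i] Qps Qps_normD Qps_normZ Qps_norm0_eq0.

End Q_functions.

Section operators.
Context {K : numFieldType}.

Definition bounded_operator {V W : normedModType K} (T : V -> W) :=
  exists k : K, forall x, `|T x| <= k * `|x|.

(* Invertibility in the algebra of bounded operators. *)
Definition invertible {V : normedModType K} (T : V -> V) :=
  exists S : {linear V -> V},
    [/\ bounded_operator S, cancel T S & cancel S T].

Definition spectrum {V : normedModType K} (T : V -> V) : set K :=
  [set l | ~ invertible (fun x => T x - l *: x)].

End operators.

Section multiplication.
Context {R : realType}.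

Definition is_multiplication_operator (p s : R) (p1 : 1 < p)
    (f : circle R -> R[i]) (T : Qps s p1 -> Qps s p1) :=
  forall g : Qps s p1,
    Qps_fun (T g) = (fun z => f z * Qps_fun g z) %[ae arc_length].

Definition essential_range (f : circle R -> R[i]) : set R[i] :=
  [set l | forall e : R, 0 < e ->
    (0 < arc_length [set z | (normc (f z - l) < e)%R])%E].

End multiplication.

(* Main.v *)
Require Import Defs.
From HB Require Import structures.
From mathcomp Require Import all_boot all_order all_algebra complex.
From mathcomp Require Import all_classical all_reals all_analysis.
From mathcomp Require Import generic_quotient ring_quotient.
From mathcomp Require Import measurable_realfun ring lra.
Import Order.TTheory GRing.Theory Num.Theory.
Local Open Scope complex_scope.
Local Open Scope classical_set_scope.
Local Open Scope ring_scope.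
Import numFieldNormedType.Exports ComplexField.Normc.

(** Write [F = f - l], so that [M - l] is multiplication by [F], and [l] lies in
the essential range of [f] iff [|F|] is not essentially bounded away from 0
([ess_vanishing]).

If [|F| >= e > 0], every [g] of the space can be divided by [F] inside the space.
With [G = F g] and [h = g / F],
<<
  h z - h w = (1 / F z + 1 / F w) (g z - g w) - (G z - G w) / (F z F w),
>>
so the seminorm of [h] is at most [2 / e] times that of [g] plus [1 / e^2] times
that of [G], whatever the kernel and the arcs are ([Q_diff_div],
[Q_seminorm_div]). As [G] is the image of [g] under the bounded operator
[M - l], division by [F] is a bounded inverse.

Conversely, let [S] be an inverse of [M - l] with [||S x|| <= k ||x||]. The
functions [u_n = S^n 1] satisfy [F^n u_n = 1] a.e. and [||u_n|| <= k^n ||u_0||].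
On [E = {|F| < e}] the former gives [1 <= e^n |u_n|], hence the [L^p] norm of the
indicator of [E] is at most [(e k)^n ||u_0||]. Taking [e = 1 / (2 k)] and letting
[n] grow, [E] is negligible, so [|F|] is essentially bounded away from 0
([multiplication_operator_noninvertible]). *)

(** * Complex-valued measurable functions *)

Lemma normr_normc {R : rcfType} (z : R[i]) : `|z| = (normc z)%:C.
Proof. by []. Qed.

Lemma normcX {R : rcfType} (z : R[i]) n : normc (z ^+ n) = normc z ^+ n.
Proof. by elim: n => [|n IH]; rewrite ?normc1// !exprS normcM IH. Qed.

Lemma cmeasurableV {R : realType} {d} {T : measurableType d} {f : T -> R[i]} :
  cmeasurable f -> cmeasurable (fun x => (f x)^-1).
Proof.
move=> mf; have mn : measurable_fun setT (fun x => normc (f x) `^ (- 2)).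
  exact: (measurableT_comp (measurable_powR (- 2)) (measurable_normc mf)).
have E x : (f x)^-1 = ((normc (f x) `^ (- 2)) * complex.Re (f x)) +i*
    (normc (f x) `^ (- 2) * - complex.Im (f x)).
  rewrite powRN powR_mulrn ?normc_ge0//; case: (f x) => a b /=.
  rewrite sqr_sqrtr ?addr_ge0 ?sqr_ge0//.
  by rewrite -[LHS]/((a / (a ^+ 2 + b ^+ 2)) -i* (b / (a ^+ 2 + b ^+ 2)))
    mulrN ![_^-1 * _]mulrC.
case: mf => rf imf; split.
- have -> : (fun x => complex.Re (f x)^-1) =
      (fun x => normc (f x) `^ (- 2) * complex.Re (f x)).
    by apply/funext => x; rewrite E.
  exact: measurable_funM.
- have -> : (fun x => complex.Im (f x)^-1) =
      (fun x => normc (f x) `^ (- 2) * - complex.Im (f x)).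
    by apply/funext => x; rewrite E.
  by apply: measurable_funM => //; exact: measurable_funN.
Qed.

Lemma cmeasurable_comp {R : realType} {d d'} {T : measurableType d}
    {T' : measurableType d'} {f : T -> R[i]} {g : T' -> T} :
  cmeasurable f -> measurable_fun setT g -> cmeasurable (f \o g).
Proof.
by move=> [rf imf] mg; split; [exact: (measurableT_comp rf)|
  exact: (measurableT_comp imf)].
Qed.

Lemma measurable_normc_lt {R : realType} {d} {T : measurableType d}
    {f : T -> R[i]} (e : R) :
  cmeasurable f -> measurable [set z | normc (f z) < e].
Proof.
move=> mf; rewrite -[X in measurable X]setTI.
have := measurable_normc mf measurableT (measurable_itv `]-oo, e[).
by rewrite preimage_itvNyo.
Qed.

(** * Comparison of L^p norms *)

Section cLnorm_le.
Context {R : realType} {d} {T : measurableType d}.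
Context (mu : {measure set T -> \bar R}) {p : R} (p1 : 1 <= p).
Implicit Types (u v m : T -> R[i]).

Lemma ae_le_cLnorm {u v} : cmeasurable u -> cmeasurable v ->
  {ae mu, forall x, normc (u x) <= normc (v x)} ->
  (cLnorm mu p u <= cLnorm mu p v)%E.
Proof.
move=> mu' mv uv; rewrite !cLnormE.
have p0 : 0 < p := p_gt0 p1.
apply: ge0_lee_poweR.
- by rewrite invr_ge0 ltW.
- by apply: integral_ge0 => x _; rewrite lee_fin powR_ge0.
apply: ae_ge0_le_integral => //.
- by move=> x _; rewrite lee_fin powR_ge0.
- exact: measurable_normc_powR.
- by move=> x _; rewrite lee_fin powR_ge0.
- exact: measurable_normc_powR.
apply: filterS uv => x uvx _; rewrite lee_fin.
by apply: ge0_ler_powR; rewrite ?nnegrE ?normc_ge0// ltW.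
Qed.

Lemma cLnormM_le {m u} {c : R} : 0 <= c -> cmeasurable m -> cmeasurable u ->
  (forall x, normc (m x) <= c) ->
  (cLnorm mu p (m \* u)%R <= c%:E * cLnorm mu p u)%E.
Proof.
move=> c0 mm mu' mc.
have nc : normc c%:C = c by rewrite /= expr0n addr0 sqrtr_sqr ger0_norm.
rewrite -[in leRHS]nc -cLnormZ//; apply: ae_le_cLnorm.
- exact: cmeasurableM.
- exact: cmeasurableM (cmeasurable_cst _) mu'.
by apply: aeW => x; rewrite !normcM nc ler_wpM2r ?normc_ge0.
Qed.

End cLnorm_le.

(** * Bounds on operators and numbers *)

Lemma iter_bound {K : numFieldType} {W : normedModType K} {S : W -> W}
    {k : K} (x : W) n : 0 <= k -> (forall y, `|S y| <= k * `|y|) -> `|iter n S x| <= k ^+ n * `|x|.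
Proof.
move=> k0 kS; elim: n => [|n IH]; first by rewrite mul1r.
by rewrite exprS -mulrA; apply: le_trans (kS _) _; rewrite ler_wpM2l.
Qed.

(** The bound in [bounded_operator] is a complex number; it is made real and
positive, so that powers and inverses of it can be compared. *)
Lemma bounded_operator_real {R : realType} {W : normedModType R[i]}
    {S : W -> W} :
  bounded_operator S ->
  exists2 k : R, 0 < k & forall x, `|S x| <= k%:C * `|x|.
Proof.
move=> [k kS]; exists (normc k + 1); first by rewrite ltr_wpDl ?normc_ge0.
move=> x; have kx : 0 <= k * `|x| by exact: le_trans (kS x).
apply: le_trans (kS x) _; rewrite -(ger0_norm kx) normrM normr_id ler_wpM2r//.
by rewrite normr_normc lecR lerDl.
Qed.

Lemma eq0_of_le_geometric {R : realType} (x : \bar R) (C : R) : (0 <= x)%E ->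
  (forall n, x <= (C / 2 ^+ n)%:E)%E -> x = 0%E.
Proof.
move=> x0 xC; apply/le_anti/andP; split=> //.
apply/lee_addgt0Pr => d d0; rewrite add0e.
have [n Cn] : exists n, C <= d * 2 ^+ n.
  exists (Num.bound `|C / d|); rewrite mulrC -ler_pdivrMr//.
  apply: le_trans (ler_norm _) _.
  apply: le_trans (ltW (archi_boundP (normr_ge0 _))) _.
  by rewrite -natrX ler_nat ltnW// ltn_expl.
by apply: le_trans (xC n) _; rewrite lee_fin ler_pdivrMr ?exprn_gt0.
Qed.

(** * Functions of the space and their classes *)

Section Q.
Context {R : realType} {p s : R} (p1 : 1 < p).
Local Notation mu := (@arc_length R).
Local Notation Qps := (Qps s p1).
Local Notation Q_fun := (Q_fun p s).
Local Open Scope quotient_scope.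

Let p1' : 1 <= p := ltW p1.

Lemma Q_space_cst c : Q_space p s (cst c : circle R -> R[i]).
Proof.
split; first exact: cmeasurable_cst.
- rewrite /Lp_norm cLnormE poweR_lty//.
  under eq_integral do rewrite /=.
  by rewrite integral_cst// lte_mul_pinfty ?lee_fin ?powR_ge0//
    [ltLHS]arc_lengthT ltry.
- apply: (@le_lt_trans _ _ 0%E); last by [].
  apply: (Q_diff_lub p1') => [||I aI]; [exact: cmeasurable_cst|by []|].
  rewrite (_ : Q_diff _ _ _ _ = cst 0); last first.
    by apply/funext => z; rewrite /Q_diff subrr mulr0.
  by rewrite (cLnorm_ae0 p1' (cmeasurable_cst 0))//; exact: aeW.
Qed.

Lemma Qps_fun_pi (g : Q_fun) : Qps_fun (\pi_Qps g) = g %[ae mu].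
Proof. exact: Qps_pi_repr. Qed.

Lemma Qps_fun_eq (x y : Qps) : Qps_fun x = Qps_fun y %[ae mu] -> x = y.
Proof. by move=> xy; rewrite -[x]reprK -[y]reprK; apply/eqP/Qps_eqP. Qed.

Lemma Qps_funB (x y : Qps) :
  Qps_fun (x - y) = (fun z => Qps_fun x z - Qps_fun y z) %[ae mu].
Proof.
by rewrite -[in x - y](reprK x) -[in _ - y](reprK y) -raddfB; exact: Qps_fun_pi.
Qed.

Lemma Qps_funZ (c : R[i]) (x : Qps) :
  Qps_fun (c *: x) = (fun z => c * Qps_fun x z) %[ae mu].
Proof. exact: Qps_fun_pi. Qed.

Lemma Lp_norm_le_Qps_norm (x : Qps) :
  Lp_norm p (Qps_fun x) = (fine (Lp_norm p (Qps_fun x)))%:E /\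
  (fine (Lp_norm p (Qps_fun x)))%:C <= `|x|.
Proof.
have [fp fs] := Q_norm_fin (Q_fun_space (repr x)).
split; first by rewrite fineK.
by rewrite lecR lerDl fine_ge0// Q_seminorm_ge0.
Qed.

Lemma Q_space_ae {g h : circle R -> R[i]} : cmeasurable h ->
  g = h %[ae mu] -> Q_space p s g -> Q_space p s h.
Proof.
move=> mh gh Qg; have [mg _ _] := Qg.
rewrite (_ : h = g \+ (h \+ (\- g))); last first.
  by apply/funext => z /=; rewrite addrC subrK.
apply: Q_spaceD => //; apply: Q_space_ae0 => //.
  by apply: cmeasurableD => //; exact: cmeasurableN.
by apply: filterS gh => z /(_ Logic.I) /= -> _; rewrite subrr.
Qed.

(** * Division by a function bounded away from zero *)

(** The bound [e <= normc (F z)] is assumed at every point, so that [F] may be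
inverted pointwise inside the double integrals; a symbol bounded below only
almost everywhere is first modified on a negligible set, see
[bounded_below_of_not_ess_vanishing]. *)
Section division.
Context {F : circle R -> R[i]} {e : R}.
Hypotheses (mF : cmeasurable F) (e0 : 0 < e) (eF : forall z, e <= normc (F z)).

Lemma normcV_le z : normc (F z)^-1 <= e^-1.
Proof. by rewrite normcV lef_pV2 ?posrE// (lt_le_trans e0). Qed.

Let F0 z : F z != 0.
Proof. by apply: contraTneq (eF z) => ->; rewrite normc0 -ltNge. Qed.

Context {g : circle R -> R[i]}.
Hypothesis mg : cmeasurable g.
Local Notation h := (fun z => (F z)^-1 * g z).
Local Notation G := (fun z => F z * g z).

Let mh : cmeasurable h. Proof. exact: cmeasurableM (cmeasurableV mF) mg. Qed.
Let mG : cmeasurable G. Proof. exact: cmeasurableM. Qed.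

(** Among the ways to expand the difference of two quotients, this one involves
differences of [F] only through [F g], which is assumed to lie in the space
below, and its coefficients stay bounded even where [F] is large. *)
Lemma Q_diff_div I : Q_diff p s h I =
  ((fun z => (F z.1)^-1 + (F z.2)^-1) \* Q_diff p s g I) \+
  ((fun z => - ((F z.1)^-1 * (F z.2)^-1)) \* Q_diff p s G I).
Proof.
apply/funext => -[z w]; rewrite /Q_diff /=.
by have := F0 z; have := F0 w => Fw Fz; field; rewrite Fw Fz.
Qed.

Lemma Lp_norm_div : (Lp_norm p h <= (e^-1)%:E * Lp_norm p g)%E.
Proof.
apply: cLnormM_le; rewrite ?invr_ge0 ?(ltW e0)//; first exact: cmeasurableV.
exact: normcV_le.
Qed.

Lemma Q_seminorm_div : (Q_seminorm p s h <=
  (2 * e^-1)%:E * Q_seminorm p s g + (e^-1 * e^-1)%:E * Q_seminorm p s G)%E.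
Proof.
have ei0 : 0 <= e^-1 by rewrite invr_ge0 ltW.
have m1 := cmeasurable_comp (cmeasurableV mF) (@measurable_fst _ _ (circle R) (circle R)).
have m2 := cmeasurable_comp (cmeasurableV mF) (@measurable_snd _ _ (circle R) (circle R)).
have mD := cmeasurableD m1 m2.
have mP := cmeasurableN (cmeasurableM m1 m2).
apply: Q_diff_lub => // [|I aI].
  by rewrite adde_ge0// mule_ge0 ?Q_seminorm_ge0// lee_fin mulr_ge0.
have mI := measurable_arc aI; rewrite Q_diff_div.
have mQg := cmeasurable_Q_diff p s mg mI.
have mQG := cmeasurable_Q_diff p s mG mI.
apply: le_trans (cLnormD _ p1' (cmeasurableM mD mQg) (cmeasurableM mP mQG)) _.
apply: leeD.
- apply: le_trans (cLnormM_le _ p1' (mulr_ge0 (ler0n _ 2) ei0) mD mQg _) _ => //.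
    move=> z; apply: le_trans (le_normcD _ _) _.
    by rewrite mulrDl mul1r lerD// normcV_le.
  by apply: lee_wpmul2l; [rewrite lee_fin mulr_ge0|exact: Q_diff_ub].
- apply: le_trans (cLnormM_le _ p1' (mulr_ge0 ei0 ei0) mP mQG _) _ => //.
    by move=> z; rewrite /= normcN normcM ler_pM ?normc_ge0 ?normcV_le.
  by apply: lee_wpmul2l; [rewrite lee_fin mulr_ge0|exact: Q_diff_ub].
Qed.

Hypotheses (Qg : Q_space p s g) (QG : Q_space p s G).

Lemma Q_space_div : Q_space p s h.
Proof.
have ei0 : 0 <= e^-1 by rewrite invr_ge0 ltW.
have [_ gp gs] := Qg; have [_ _ Gs] := QG; split=> //.
  by apply: le_lt_trans Lp_norm_div _; rewrite lte_mul_pinfty.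
apply: le_lt_trans Q_seminorm_div _.
by rewrite lte_add_pinfty ?lte_mul_pinfty ?lee_fin ?mulr_ge0.
Qed.

Lemma Q_norm_div :
  Q_norm p s h <= 2 * e^-1 * Q_norm p s g + e^-1 * e^-1 * Q_norm p s G.
Proof.
have ei0 : 0 <= e^-1 by rewrite invr_ge0 ltW.
have [hp hs] := Q_norm_fin Q_space_div.
have [gp gs] := Q_norm_fin Qg; have [Gp Gs] := Q_norm_fin QG.
have := Lp_norm_div; have := Q_seminorm_div.
rewrite -(fineK hp) -(fineK hs) -(fineK gp) -(fineK gs) -(fineK Gs) -!EFinM.
rewrite -EFinD !lee_fin /Q_norm => A B.
have Lg0 : 0 <= fine (Lp_norm p g) by rewrite fine_ge0// cLnorm_ge0.
have LG0 : 0 <= fine (Lp_norm p G) by rewrite fine_ge0// cLnorm_ge0.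
have := mulr_ge0 ei0 Lg0; have := mulr_ge0 (mulr_ge0 ei0 ei0) LG0.
lra.
Qed.

End division.

End Q.

(** * The operator of multiplication *)

(** This is [0 \in essential_range F], spelled so that it becomes
[essential_range f l] by conversion when [F] is [f - l]. *)
Definition ess_vanishing {R : realType} (F : circle R -> R[i]) : Prop :=
  forall e : R, 0 < e -> (0 < arc_length [set z | (normc (F z) < e)%R])%E.

Lemma bounded_below_of_not_ess_vanishing {R : realType}
    {F : circle R -> R[i]} : cmeasurable F -> ~ ess_vanishing F ->
  exists2 e : R, 0 < e & exists2 H : circle R -> R[i], cmeasurable H &
    (forall z, e <= normc (H z)) /\ F = H %[ae arc_length].
Proof.
move=> mF /existsNP[e /not_implyP[e0 /negP]]; rewrite -leNgt => Fe.
exists e => //; exists (fun z => if normc (F z) < e then e%:C else F z).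
  have mlt : measurable_fun [set: circle R] (fun z => normc (F z) < e).
    apply: measurable_fun_ltr; last exact: measurable_cst.
    exact: measurable_normc.
  have [rF iF] := mF; split.
    under eq_fun do rewrite (fun_if (@complex.Re R)).
    by apply: measurable_fun_ifT => //; exact: measurable_cst.
  under eq_fun do rewrite (fun_if (@complex.Im R)).
  by apply: measurable_fun_ifT => //; exact: measurable_cst.
split=> [z|].
  case: ifPn => [_|]; last by rewrite -leNgt.
  by rewrite /= expr0n addr0 sqrtr_sqr ler_norm.
exists [set z | normc (F z) < e]; split; first exact: measurable_normc_lt.
  by apply/eqP; rewrite eq_le Fe measure_ge0.
by move=> z /=; apply: contra_notP => /negP/negbTE ->.
Qed.

Section operator.
Context {R : realType} {p s : R} {p1 : 1 < p}.
Local Notation mu := (@arc_length R).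
Local Notation V := (Qps s p1).
Local Open Scope quotient_scope.

Lemma multiplication_operatorB (f : circle R -> R[i]) (l : R[i]) (M : V -> V) :
  is_multiplication_operator f M ->
  is_multiplication_operator (fun z => f z - l) (fun x => M x - l *: x).
Proof.
move=> fM g; apply: filterS3 (Qps_funB p1 (M g) (l *: g)) (fM g) (Qps_funZ p1 l g).
move=> z /(_ Logic.I) + /(_ Logic.I) + /(_ Logic.I) + _.
by move=> -> -> ->; rewrite mulrBl.
Qed.

Section symbol.
Context {F : circle R -> R[i]} (mF : cmeasurable F).

Section bounded_below.
Variable T : {linear V -> V}.
Hypotheses (FT : is_multiplication_operator F T) (bT : bounded_operator T).
Hypothesis F0 : ~ ess_vanishing F.

Lemma multiplication_operator_inj : injective T.
Proof.
have [e e0 [H mH [eH FH]]] := bounded_below_of_not_ess_vanishing mF F0.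
move=> x y Txy; apply: Qps_fun_eq.
apply: filterS3 (FT x) (FT y) FH.
move=> z /(_ Logic.I) + /(_ Logic.I) + /(_ Logic.I) FHz _.
rewrite Txy FHz => ->; apply: mulfI.
by apply: contraTneq (eH z) => ->; rewrite normc0 -ltNge.
Qed.

(** The preimage of [x] is the class of [x / H], where [H] is a version of [F]
bounded below everywhere; its norm is controlled by those of [x] and [T x]. *)
Lemma multiplication_operator_surj :
  exists k : R[i], forall x, exists2 y, T y = x & `|y| <= k * `|x|.
Proof.
have [e e0 [H mH [eH FH]]] := bounded_below_of_not_ess_vanishing mF F0.
have H0 z : H z != 0.
  by apply: contraTneq (eH z) => ->; rewrite normc0 -ltNge.
have [k kT] := bT.
exists ((2 * e^-1)%:C + (e^-1 * e^-1)%:C * k) => x.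
have Qg := Q_fun_space (repr x); have [mg _ _] := Qg.
have HT : Qps_fun (T x) = (fun z => H z * Qps_fun x z) %[ae mu].
  by apply: filterS2 (FT x) FH => z /(_ Logic.I) -> /(_ Logic.I) -> _.
have QG := Q_space_ae p1 (cmeasurableM mH mg) HT (Q_fun_space (repr (T x))).
have Qh := Q_space_div p1 mH e0 eH mg Qg QG.
pose h := MkQ_fun (introT (asboolP _) Qh).
pose G := MkQ_fun (introT (asboolP _) QG).
exists (\pi_V h).
  apply: Qps_fun_eq.
  apply: filterS3 (FT (\pi_V h)) (Qps_fun_pi p1 h) FH.
  move=> z /(_ Logic.I) + /(_ Logic.I) + /(_ Logic.I) FHz _ => -> ->.
  by rewrite FHz mulVKf.
have TG : `|T x| = (Q_norm p s G)%:C.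
  rewrite -(Qps_norm_pi p1 G); congr (Qps_norm _); apply: Qps_fun_eq.
  apply: filterS2 HT (Qps_fun_pi p1 G).
  by move=> z /(_ Logic.I) + /(_ Logic.I) + _ => -> ->.
rewrite mulrDl -mulrA.
apply: (@le_trans _ _ ((2 * e^-1)%:C * `|x| + (e^-1 * e^-1)%:C * `|T x|)); last first.
  by rewrite lerD2l ler_wpM2l// lecR mulr_ge0// invr_ge0 ltW.
rewrite TG [`|_|](Qps_norm_pi p1 h) [`|x|]/(_%:C) -!rmorphM -rmorphD/= lecR.
exact: Q_norm_div.
Qed.

Lemma multiplication_operator_invertible : invertible T.
Proof.
have [k /choice[S S_]] : exists k, forall x, exists y, T y = x /\ `|y| <= k * `|x|.
  have [k kP] := multiplication_operator_surj.
  by exists k => x; have [y] := kP x; exists y.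
have TS : cancel S T by move=> x; have [] := S_ x.
have ST : cancel T S by move=> x; apply: multiplication_operator_inj.
have linS : linear S.
  by move=> a x y; apply: multiplication_operator_inj; rewrite linearP !TS.
exists (HB.pack_for {linear V -> V} S (GRing.isLinear.Build _ _ _ _ S linS)).
by split => //; exists k => x; have [] := S_ x.
Qed.

End bounded_below.

(** The growth of the iterates of the inverse on the constant function 1 is at most
geometric with ratio [k], whereas they are at least [e ^- n] on [{|F| < e}]. *)
Lemma multiplication_operator_noninvertible (T : V -> V) :
  is_multiplication_operator F T -> ess_vanishing F -> ~ invertible T.
Proof.
move=> FT F0 [S [/bounded_operator_real[k k0 kS] _ TS]].
have Q1 : Q_space p s (cst 1) := Q_space_cst p1 1.
pose one : Q_fun p s := MkQ_fun (introT (asboolP _) Q1).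
pose u n := iter n S (\pi_V one).
have Fu n : {ae mu, forall z, F z ^+ n * Qps_fun (u n) z = 1}.
  elim: n => [|n].
    apply: filterS (Qps_fun_pi p1 one) => z /(_ Logic.I).
    by rewrite mul1r.
  apply: filterS2 (FT (u n.+1)) => z /(_ Logic.I).
  by rewrite [T _]TS => ->; rewrite exprSr mulrA.
(* With this choice e * k = 1 / 2, which makes the bounds below tend to 0. *)
pose e := (2 * k)^-1; have e0 : 0 < e by rewrite invr_gt0 mulr_gt0.
pose E := [set z | normc (F z) < e].
have mE : measurable E by exact: measurable_normc_lt.
pose v : circle R -> R[i] := fun z => (\1_E z)%:C.
have mv : cmeasurable v by apply: cmeasurable_real; exact: measurable_indic.
have p1' := ltW p1.
have vu n : (Lp_norm p v <= (e ^+ n * (k ^+ n * complex.Re `|u 0|))%:E)%E.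
  have [Lu uN] := Lp_norm_le_Qps_norm p1 (u n).
  have mu_ : cmeasurable (Qps_fun (u n)) by have [] := Q_fun_space (repr (u n)).
  apply: (@le_trans _ _ ((e ^+ n)%:E * Lp_norm p (Qps_fun (u n)))%E).
    have nc : normc (e ^+ n)%:C = e ^+ n.
      by rewrite /= expr0n addr0 sqrtr_sqr ger0_norm// exprn_ge0// ltW.
    rewrite -[in leRHS]nc -(cLnormZ _ p1')//; apply: ae_le_cLnorm => //.
      exact: cmeasurableM (cmeasurable_cst _) mu_.
    apply: filterS (Fu n) => z Fuz.
    rewrite normcM nc /v indicE; case: (boolP (z \in E)) => [|_]; last first.
      by rewrite normc0 mulr_ge0 ?normc_ge0// exprn_ge0// ltW.
    rewrite inE /E/= => /ltW ze; rewrite -[leLHS]/(normc 1) -[X in normc X <= _]Fuz.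
    rewrite normcM ler_wpM2r ?normc_ge0// normcX.
    by apply: lerXn2r; rewrite ?nnegrE ?normc_ge0// ltW.
  rewrite Lu -EFinM lee_fin ler_pM2l ?exprn_gt0//.
  have := iter_bound (u 0%N) n _ kS; rewrite lecR (ltW k0) => /(_ isT).
  move/(le_trans uN).
  by rewrite [`|u 0%N|]/((_)%:C) -rmorphXn -rmorphM/= lecR.
have v0 : Lp_norm p v = 0%E.
  apply: (@eq0_of_le_geometric _ _ (complex.Re `|u 0|)); first exact: cLnorm_ge0.
  move=> n; apply: le_trans (vu n) _.
  rewrite lee_fin mulrA -exprMn /e invfM -mulrA mulVf ?gt_eqF//.
  by rewrite mulr1 exprVn mulrC.
have := F0 _ e0; rewrite -/E.
have [N [mN N0 sub]] := cLnorm_eq0 p1' mv v0.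
by rewrite ltNge -N0 le_measure ?inE// => z Ez; apply: sub => /(_ Logic.I)/eqP;
  rewrite /v indicE mem_set//= oner_eq0.
Qed.

End symbol.
End operator.

Theorem theorem1p2 (R : realType) (p s : R) (p1 : 1 < p) (s01 : 0 < s < 1)
    (f : circle R -> R[i]) (mf : cmeasurable f)
    (M : {linear Qps s p1 -> Qps s p1}) (bM : bounded_operator M)
    (fM : is_multiplication_operator f M) :
  spectrum M = essential_range f.
Proof.
have mfl l : cmeasurable (fun z => f z - l).
  exact: cmeasurableD (cmeasurable_cst (- l)).
apply/seteqP; split=> l; last first.
  exact: (multiplication_operator_noninvertible (mfl l) _
    (multiplication_operatorB f l M fM)).
apply: contra_notP => fl.
pose T : {linear Qps s p1 -> Qps s p1} := M \- (l \*: idfun).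
apply: (multiplication_operator_invertible (mfl l) T _ _ fl).
  exact: multiplication_operatorB.
have [k kM] := bM; exists (k + `|l|) => x.
rewrite mulrDl -normrZ; apply: le_trans (ler_normB _ _) _.
by rewrite lerD2r.
Qed.
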